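(* Let $r$ be a nonnegative integer and $n$ an integer with $n\ge r$. Then \[ \begin{aligned} H_n(x)=\;&n!\sum_{k=0}^{r-1}\left\{\sum_{j=0}^{k}\sum_{l=0}^{n}\frac{(r-k)!\,S_2(l+r-k,r-k)\,(-1)^{k-j}\binom{k}{j}2^l H_{n-l}(j)}{(l+r-k)!\,k!\,(n-l)!}\right\}B_k^{(r)}(x)\\ &+n!\sum_{k=r}^{n}\left\{\sum_{j=0}^{r}\frac{(-1)^{r-j}\binom{r}{j}2^{k-r}H_{n-k+r}(j)}{k!\,(n-k+r)!}\right\}B_k^{(r)}(x). \end{aligned} \]
   Context: The Hermite polynomials $H_n(x)$ are defined by $e^{2xt-t^2}=\sum_{n\ge0}H_n(x)\frac{t^n}{n!}$. The Bernoulli polynomials of order $r$ are defined by $\left(\frac{t}{e^t-1}\right)^r e^{xt}=\sum_{n\ge0}B_n^{(r)}(x)\frac{t^n}{n!}$. The Stirling numbers of the second kind $S_2(l,n)$ are defined by $(e^t-1)^n=n!\sum_{l\ge n}S_2(l,n)\frac{t^l}{l!}$. *)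

(* Defs.v *)
(* [boolp] supplies the equality and choice structures on nat -> R. *)
From HB Require Import structures.
From mathcomp Require Import all_boot all_order all_algebra.
From mathcomp Require Import boolp.

Set Implicit Arguments.
Unset Strict Implicit.
Unset Printing Implicit Defensive.

Import GRing.Theory Num.Theory.
Local Open Scope ring_scope.

(* Formal power series in one variable t. All generating functions below are
   identities between formal power series. *)
Record fps (R : Type) := Fps { fcoef : nat -> R }.

Arguments fcoef {R} _ _.

HB.instance Definition _ (R : Type) := [isNew for @fcoef R].
HB.instance Definition _ (R : choiceType) := [Equality of fps R by <:].
HB.instance Definition _ (R : choiceType) := [Choice of fps R by <:].

Lemma fpsP (R : Type) (f g : fps R) :
  (forall n, fcoef f n = fcoef g n) -> f = g.
Proof. by case: f g => [f] [g] /= /funext ->. Qed.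

Section FpsZmod.
Variable R : zmodType.
Implicit Types f g h : fps R.

Definition fps_zero : fps R := Fps (fun=> 0).
Definition fps_opp f : fps R := Fps (fun n => - fcoef f n).
Definition fps_add f g : fps R := Fps (fun n => fcoef f n + fcoef g n).

Fact fps_addA : associative fps_add.
Proof. by move=> f g h; apply: fpsP => n /=; rewrite addrA. Qed.
Fact fps_addC : commutative fps_add.
Proof. by move=> f g; apply: fpsP => n /=; rewrite addrC. Qed.
Fact fps_add0 : left_id fps_zero fps_add.
Proof. by move=> f; apply: fpsP => n /=; rewrite add0r. Qed.
Fact fps_addN : left_inverse fps_zero fps_opp fps_add.
Proof. by move=> f; apply: fpsP => n /=; rewrite addNr. Qed.

HB.instance Definition _ := GRing.isZmodule.Build (fps R)
  fps_addA fps_addC fps_add0 fps_addN.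

Lemma fcoef0 n : fcoef (0 : fps R) n = 0. Proof. by []. Qed.
Lemma fcoefN f n : fcoef (- f) n = - fcoef f n. Proof. by []. Qed.
Lemma fcoefD f g n : fcoef (f + g) n = fcoef f n + fcoef g n.
Proof. by []. Qed.
Lemma fcoefB f g n : fcoef (f - g) n = fcoef f n - fcoef g n.
Proof. by []. Qed.

Lemma fcoef_sum I (s : seq I) (P : pred I) (F : I -> fps R) n :
  fcoef (\sum_(i <- s | P i) F i) n = \sum_(i <- s | P i) fcoef (F i) n.
Proof.
exact: (big_morph (fun f => fcoef f n) (fun f g => fcoefD f g n) (fcoef0 n)).
Qed.
End FpsZmod.

Section FpsRing.
Variable R : comNzRingType.
Implicit Types f g h : fps R.

Definition fps_const (c : R) : fps R := Fps (fun n => if n == 0%N then c else 0).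

Definition fps_mul f g : fps R :=
  Fps (fun n => \sum_(i < n.+1) fcoef f i * fcoef g (n - i)).

Let trunc N f : {poly R} := \poly_(i < N) fcoef f i.

Let coef_trunc N f n : (n < N)%N -> (trunc N f)`_n = fcoef f n.
Proof. by move=> ltnN; rewrite coef_poly ltnN. Qed.

Let coef_eqM (p p' q q' : {poly R}) N :
    (forall i, (i < N)%N -> p`_i = p'`_i) -> (forall i, (i < N)%N -> q`_i = q'`_i) ->
  forall n, (n < N)%N -> (p * q)`_n = (p' * q')`_n.
Proof.
move=> Ep Eq n ltnN; rewrite !coefM; apply: eq_bigr => i _.
rewrite Ep ?Eq //; first by rewrite (leq_ltn_trans (leq_subr _ _)).
by rewrite (leq_trans (ltn_ord i)).
Qed.

Let fps_mulE N f g n : (n < N)%N ->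
  fcoef (fps_mul f g) n = (trunc N f * trunc N g)`_n.
Proof.
move=> ltnN; rewrite coefM; apply: eq_bigr => i _.
rewrite !coef_trunc //; first by rewrite (leq_ltn_trans (leq_subr _ _)).
by rewrite (leq_trans (ltn_ord i)).
Qed.

Fact fps_mulC : commutative fps_mul.
Proof.
by move=> f g; apply: fpsP => n; rewrite !(@fps_mulE n.+1) // mulrC.
Qed.

Fact fps_mulA : associative fps_mul.
Proof.
move=> f g h; apply: fpsP => n; rewrite !(@fps_mulE n.+1) //.
have E f1 f2 i : (i < n.+1)%N ->
    (trunc n.+1 (fps_mul f1 f2))`_i = (trunc n.+1 f1 * trunc n.+1 f2)`_i.
  by move=> lt_in; rewrite coef_trunc // (@fps_mulE n.+1).
rewrite (@coef_eqM _ (trunc n.+1 f) _ _ n.+1 _ (E g h)) // mulrA.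
by apply: esym; apply: (coef_eqM (E f g)).
Qed.

Fact fps_mul1 : left_id (fps_const 1) fps_mul.
Proof.
move=> f; apply: fpsP => n /=; rewrite big_ord_recl /= subn0 mul1r.
by rewrite big1 ?addr0 // => i _; rewrite mul0r.
Qed.

Fact fps_mulDl : left_distributive fps_mul +%R.
Proof.
move=> f g h; apply: fpsP => n; rewrite fcoefD /= -big_split /=.
by apply: eq_bigr => i _; rewrite mulrDl.
Qed.

Fact fps_oner_neq0 : fps_const 1 != 0.
Proof.
apply/eqP => /(congr1 (fun f => fcoef f 0)) /= /eqP.
by rewrite (oner_eq0 R).
Qed.

HB.instance Definition _ := GRing.Zmodule_isComNzRing.Build (fps R)
  fps_mulA fps_mulC fps_mul1 fps_mulDl fps_oner_neq0.

Lemma fcoef1 n : fcoef (1 : fps R) n = (n == 0%N)%:R.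
Proof. by rewrite /=; case: eqP. Qed.

Lemma fcoefM f g n :
  fcoef (f * g) n = \sum_(i < n.+1) fcoef f i * fcoef g (n - i).
Proof. by []. Qed.

Lemma fcoef0M f g : fcoef (f * g) 0 = fcoef f 0 * fcoef g 0.
Proof. by rewrite fcoefM big_ord1. Qed.

Lemma fcoefCM c f n : fcoef (fps_const c * f) n = c * fcoef f n.
Proof.
rewrite fcoefM big_ord_recl /= subn0 big1 ?addr0 // => i _.
by rewrite mul0r.
Qed.

Lemma fcoefX_small f k n : fcoef f 0 = 0 -> (n < k)%N -> fcoef (f ^+ k) n = 0.
Proof.
move=> f0; elim: k n => // k IHk n le_nk; rewrite exprS fcoefM.
rewrite big_ord_recl f0 mul0r add0r big1 // => i _.
rewrite IHk ?mulr0 //; case: n le_nk i => [|n] le_nk i; first by case: i.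
by rewrite /= /bump /= add1n subSS (leq_ltn_trans (leq_subr _ _)).
Qed.

Definition fps_t : fps R := Fps (fun n => (n == 1%N)%:R).

(* f / t, meaningful when f has no constant term. *)
Definition fps_divt f : fps R := Fps (fun n => fcoef f n.+1).

Lemma fps_divtK f : fcoef f 0 = 0 -> fps_divt f * fps_t = f.
Proof.
move=> f0; apply: fpsP => -[|n]; rewrite mulrC fcoefM.
  by rewrite big_ord1 mul0r.
rewrite big_ord_recl mul0r add0r big_ord_recl /= mul1r subSS subn0.
by rewrite big1 ?addr0 // => i _; rewrite mul0r.
Qed.
End FpsRing.

Arguments fps_t {R}.

Section FpsUnitRing.
Variable R : comUnitRingType.
Implicit Types f g h : fps R.

Definition fps_unit : {pred fps R} :=
  [pred f | fcoef f 0 \is a GRing.unit].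

(* With c = f_0, the geometric series c^-1 * \sum_k (1 - c^-1 f)^k; powers
   beyond the n-th do not contribute to the coefficient of t^n. *)
Definition fps_inv f : fps R :=
  if f \in fps_unit then
    let c := (fcoef f 0)^-1 in
    Fps (fun n =>
      c * \sum_(k < n.+1) fcoef ((1 - fps_const c * f) ^+ k) n)
  else f.

Fact fps_mulVf : {in fps_unit, left_inverse 1 fps_inv *%R}.
Proof.
move=> f uf; rewrite /fps_inv uf /=; set c := _^-1.
set u := 1 - fps_const c * f; set g := Fps _.
have u0 : fcoef u 0 = 0.
  by rewrite fcoefB fcoefCM fcoef1 /= mulVr ?subrr.
have gE N n : (n < N)%N ->
    fcoef g n = fcoef (fps_const c * \sum_(k < N) u ^+ k) n.
  move=> ltnN; rewrite fcoefCM fcoef_sum /=; congr (_ * _).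
  rewrite (big_ord_widen N (fun k => fcoef (u ^+ k) n)) // big_mkcond /=.
  apply: eq_bigr => k _; case: ltnP => // lt_nk.
  by rewrite fcoefX_small.
apply: fpsP => n.
have -> : fcoef (g * f) n =
    fcoef ((fps_const c * \sum_(k < n.+1) u ^+ k) * f) n.
  by rewrite !fcoefM; apply: eq_bigr => i _; rewrite (gE n.+1).
rewrite mulrAC -[fps_const c * f](subKr 1) -/u -[1 in X in X * _](expr1n _ n.+1).
have -> : (1 ^+ n.+1 - u) * \sum_(k < n.+1) u ^+ k = 1 - u ^+ n.+1.
  rewrite expr1n -[in RHS](expr1n _ n.+1) subrXX; congr (_ * _).
  by apply: eq_bigr => i _; rewrite expr1n mul1r.
by rewrite fcoefB fcoefX_small // subr0.
Qed.

Fact fps_unitPl f g : g * f = 1 -> fps_unit f.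
Proof.
move=> /(congr1 (fun h => fcoef h 0)); rewrite fcoef0M fcoef1 => gf1.
by apply/unitrPr; exists (fcoef g 0); rewrite mulrC.
Qed.

Fact fps_inv_out : {in [predC fps_unit], fps_inv =1 id}.
Proof. by move=> f; rewrite inE /= /fps_inv => /negbTE ->. Qed.

HB.instance Definition _ := GRing.ComNzRing_hasMulInverse.Build (fps R)
  fps_mulVf fps_unitPl fps_inv_out.

Lemma fps_unitE f : (f \is a GRing.unit) = (fcoef f 0 \is a GRing.unit).
Proof. by []. Qed.

(* \sum_k f^k / k!, meaningful when f has no constant term: powers beyond the
   n-th then do not contribute to the coefficient of t^n. *)
Definition fps_exp f : fps R :=
  Fps (fun n => \sum_(k < n.+1) fcoef (f ^+ k) n / k`!%:R).

(* \sum_n a_n t^n / n! *)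
Definition egf (a : nat -> R) : fps R := Fps (fun n => a n / n`!%:R).
End FpsUnitRing.

Section Families.
Variable F : numFieldType.

(* Series in t with coefficients in F[x]; x is 'X. *)
Local Notation x := (fps_const ('X : {poly F})).
Local Notation t := fps_t.

Definition hermite_series : fps {poly F} :=
  fps_exp (2%:R * x * t - t ^+ 2).

(* e^t - 1 is not a unit, so t / (e^t - 1) is the inverse of (e^t - 1) / t. *)
Definition bernoulli_series (r : nat) : fps {poly F} :=
  (fps_divt (fps_exp t - 1))^-1 ^+ r * fps_exp (x * t).

Definition hermite (n : nat) : {poly F} :=
  n`!%:R * fcoef hermite_series n.

Definition bernoulli (r n : nat) : {poly F} :=
  n`!%:R * fcoef (bernoulli_series r) n.

(* The Stirling numbers of the second kind, as elements of F. *)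
Definition stirling2 (l n : nat) : F :=
  l`!%:R / n`!%:R * fcoef ((fps_exp t - 1) ^+ n) l.
End Families.

Arguments hermite {F} n.
Arguments bernoulli {F} r n.
Arguments stirling2 {F} l n.

Section GeneratingFunctions.
Variable F : numFieldType.
Local Notation x := (fps_const ('X : {poly F})).
Local Notation t := fps_t.

Let fact_neq0 n : n`!%:R != 0 :> F.
Proof. by rewrite pnatr_eq0 -lt0n fact_gt0. Qed.

Let factP_unit n : (n`!%:R : {poly F}) \is a GRing.unit.
Proof. by rewrite -polyC_natr poly_unitE coefC size_polyC fact_neq0 unitfE fact_neq0. Qed.

Let egf_fact (f : fps {poly F}) : egf (fun n => n`!%:R * fcoef f n) = f.
Proof. by apply: fpsP => n /=; rewrite mulrAC divrr ?mul1r. Qed.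

Lemma hermite_gf : fps_exp (2%:R * x * t - t ^+ 2) = egf hermite.
Proof. by rewrite egf_fact. Qed.

Lemma fcoef_exp_t (R : comUnitRingType) n :
  fcoef (fps_exp (t : fps R)) n = n`!%:R^-1.
Proof.
have tX k m : fcoef ((t : fps R) ^+ k) m = (m == k)%:R.
  elim: k m => [|k IHk] m; first by rewrite expr0 fcoef1.
  rewrite exprSr; have -> : t ^+ k = fps_divt (Fps (fun i => (i == k.+1)%:R : R)).
    by apply: fpsP => i; rewrite IHk.
  by rewrite fps_divtK.
rewrite /= big_ord_recr /= tX eqxx mul1r big1 ?add0r // => i _.
by rewrite tX gtn_eqF ?mul0r // ltn_ord.
Qed.

Let expt1_coef0 (R : comUnitRingType) :
  fcoef (fps_exp (t : fps R) - 1) 0 = 0.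
Proof. by rewrite fcoefB fcoef_exp_t fcoef1 /= fact0 invr1 subrr. Qed.

Lemma bernoulli_base_gf :
  (fps_exp t - 1) * (fps_divt (fps_exp t - 1))^-1 = t :> fps {poly F}.
Proof.
rewrite -{1}[fps_exp t - 1]fps_divtK ?expt1_coef0 // mulrAC divrr ?mul1r //.
have u1 : fcoef (fps_exp (t : fps {poly F}) - 1) 1 \is a GRing.unit.
  by rewrite fcoefB fcoef_exp_t fcoef1 subr0 invr1 unitr1.
exact: u1.
Qed.

Lemma bernoulli_gf r :
  (fps_divt (fps_exp t - 1))^-1 ^+ r * fps_exp (x * t) = egf (bernoulli r).
Proof. by rewrite egf_fact. Qed.

Lemma stirling2_small l n : (l < n)%N -> stirling2 l n = 0 :> F.
Proof. by move=> lt_ln; rewrite /stirling2 fcoefX_small ?mulr0 ?expt1_coef0. Qed.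

Lemma stirling2_gf n :
  (fps_exp t - 1) ^+ n = n`!%:R * egf (stirling2^~ n) :> fps F.
Proof.
have constn m : m%:R = fps_const (m%:R : F).
  elim: m => [|m IHm]; first by apply: fpsP => k /=; case: eqP.
  rewrite -natr1 IHm; apply: fpsP => k; rewrite fcoefD /=.
  by case: eqP => _; rewrite ?natr1 ?addr0.
have cancel (a b c : F) : a != 0 -> b != 0 -> c = b * (a / b * c / a).
  move=> a0 b0; rewrite [a / b]mulrC -(mulrA b^-1) [a * c]mulrC.
  by rewrite [b^-1 * _]mulrA mulfK // mulVKf.
apply: fpsP => l; rewrite constn fcoefCM.
exact: (cancel l`!%:R).
Qed.
End GeneratingFunctions.

(* Main.v *)
(* With G(s) = (e^s - 1)/s, the defining series give
     e^(2xt - t^2) = e^(-t^2) G(2t)^r * (2t/(e^(2t) - 1))^r e^(2xt),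
   so n! 2^k/k! [t^(n-k)] e^(-t^2) G(2t)^r is the coefficient of B_k^(r) in H_n.
   Multiply by (2t)^min(k,r): each factor 2t turns one G(2t) into e^(2t) - 1,
   powers of e^(2t) times e^(-t^2) generate the Hermite values H_m(j), and the
   remaining powers of G are expressed by Stirling numbers. *)
From HB Require Import structures.
Require Import Defs.
From mathcomp Require Import all_boot all_order all_algebra.
From mathcomp Require Import ring.
Import GRing.Theory Num.Theory.
Local Open Scope ring_scope.

(** The map f(t) -> (phi f)(a t). One ring morphism covers the rescaling t -> 2t, the embedding of
    [F] into [F[x]] and the evaluation of x at a point. *)
Definition fps_subst {R S : comNzRingType} (phi : {rmorphism R -> S}) (a : S)
    (f : fps R) : fps S :=
  Fps (fun n => phi (fcoef f n) * a ^+ n).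

Section Subst.
Variables (R S : comNzRingType) (phi : {rmorphism R -> S}) (a : S).

Fact fps_subst_zmod_morphism : zmod_morphism (fps_subst phi a).
Proof. by move=> f g; apply: fpsP => n; rewrite fcoefB /= rmorphB mulrBl. Qed.

Fact fps_subst_monoid_morphism : monoid_morphism (fps_subst phi a).
Proof.
split=> [|f g]; apply: fpsP => n.
  rewrite fcoef1 /=; case: n => [|n]; first by rewrite rmorph1 mulr1.
  by rewrite rmorph0 mul0r.
rewrite fcoefM /= rmorph_sum mulr_suml; apply: eq_bigr => i _.
by rewrite rmorphM /= mulrACA -exprD subnKC // -ltnS.
Qed.

HB.instance Definition _ := GRing.isZmodMorphism.Build
  (fps R) (fps S) (fps_subst phi a) fps_subst_zmod_morphism.
HB.instance Definition _ := GRing.isMonoidMorphism.Build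
  (fps R) (fps S) (fps_subst phi a) fps_subst_monoid_morphism.

Lemma fcoef_subst f n : fcoef (fps_subst phi a f) n = phi (fcoef f n) * a ^+ n.
Proof. by []. Qed.

Lemma fps_subst_t : fps_subst phi a fps_t = fps_const a * fps_t.
Proof.
apply: fpsP => n; rewrite fcoefCM /= rmorph_nat.
by case: n => [|[|n]]; rewrite ?mulr0 ?mul0r // mul1r mulr1.
Qed.

Lemma fps_subst_const c : fps_subst phi a (fps_const c) = fps_const (phi c).
Proof.
by apply: fpsP => -[|n] /=; rewrite ?mulr1 ?rmorph0 ?mul0r.
Qed.
End Subst.

(** The cutoff in [fps_exp] depends only on the degree, which the substitution preserves; invertible
    factorials let [phi] pass through the divisions. *)
Lemma fps_subst_exp {R S : comUnitRingType} (phi : {rmorphism R -> S}) (a : S)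
    (f : fps R) : (forall n, (n`!%:R : R) \is a GRing.unit) ->
  fps_subst phi a (fps_exp f) = fps_exp (fps_subst phi a f).
Proof.
move=> uR; apply: fpsP => n; rewrite /= rmorph_sum mulr_suml.
apply: eq_bigr => k _; rewrite rmorph_div // rmorph_nat mulrAC.
by rewrite -rmorphXn.
Qed.

(** * Powers of t and constant series *)

Section FpsShift.
Variable R : comNzRingType.
Implicit Types f g : fps R.

Lemma fcoef_tXM f k n :
  fcoef (fps_t ^+ k * f) n = if (k <= n)%N then fcoef f (n - k) else 0.
Proof.
elim: k n => [|k IHk] n; first by rewrite expr0 mul1r leq0n subn0.
rewrite exprS -mulrA fcoefM; case: n => [|n]; first by rewrite big_ord1 mul0r.
rewrite !big_ord_recl mul0r add0r big1 => [|i _]; last by rewrite mul0r.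
by rewrite addr0 [fcoef fps_t _]/= mul1r IHk lift0 subSS /= subn0.
Qed.

Lemma fps_const_natr m : fps_const (m%:R : R) = m%:R.
Proof.
elim: m => [|m IHm]; first by apply: fpsP => k /=; case: eqP.
rewrite -[in RHS]natr1 -IHm; apply: fpsP => k; rewrite fcoefD fcoef1 /=.
by case: eqP => _; rewrite ?natr1 ?addr0.
Qed.

Lemma fps_constM (a b : R) : fps_const (a * b) = fps_const a * fps_const b.
Proof. by apply: fpsP => n; rewrite fcoefCM /=; case: eqP; rewrite ?mulr0. Qed.

Lemma fps_const_sign m : fps_const ((-1) ^+ m : R) = (-1) ^+ m.
Proof.
rewrite -signr_odd -[in RHS]signr_odd; case: (odd m); last exact: fpsP.
by rewrite !expr1; apply: fpsP => -[|n]; rewrite fcoefN fcoef1 //= oppr0.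
Qed.

(** Both series are divisible by t, so the product is divisible by t^(i+j). *)
Lemma fcoefXM_small f g i j n : fcoef f 0 = 0 -> fcoef g 0 = 0 ->
  (n < i + j)%N -> fcoef (f ^+ i * g ^+ j) n = 0.
Proof.
move=> f0 g0; rewrite -(fps_divtK f0) -(fps_divtK g0) !exprMn => ltn.
have -> : forall u v w z : fps R, u * v * (w * z) = v * z * (u * w).
  by move=> *; ring.
by rewrite -exprD fcoef_tXM leqNgt ltn.
Qed.
End FpsShift.

(** * The functional equation of the exponential *)

Section FpsExp.
Variable R : comUnitRingType.
Hypothesis factU : forall n, (n`!%:R : R) \is a GRing.unit.
Implicit Types f g : fps R.

(** A cutoff [N] common to all degrees below it turns [fps_exp f] into a polynomial in [f], to which
    ring identities apply. *)
Lemma fcoef_exp_trunc f N n : fcoef f 0 = 0 -> (n < N)%N ->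
  fcoef (fps_exp f) n = fcoef (\sum_(k < N) fps_const k`!%:R^-1 * f ^+ k) n.
Proof.
move=> f0 ltnN; rewrite fcoef_sum [LHS]/=.
rewrite (big_ord_widen N (fun k => fcoef (f ^+ k) n / k`!%:R)) // big_mkcond.
apply: eq_bigr => k _; rewrite fcoefCM mulrC; case: ltnP => // lt_nk.
by rewrite fcoefX_small // mulr0.
Qed.

(** After truncation, the left side sums f^i g^j / (i! j!) over the triangle i + j <= n and the
    right side over the square i, j <= n; the excess terms have order above n in t. *)
Lemma fps_expD f g : fcoef f 0 = 0 -> fcoef g 0 = 0 ->
  fps_exp (f + g) = fps_exp f * fps_exp g.
Proof.
move=> f0 g0; apply: fpsP => n.
have fg0 : fcoef (f + g) 0 = 0 by rewrite fcoefD f0 g0 addr0.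
pose T (h : fps R) := \sum_(k < n.+1) fps_const k`!%:R^-1 * h ^+ k.
have -> : fcoef (fps_exp f * fps_exp g) n = fcoef (T f * T g) n.
  rewrite !fcoefM; apply: eq_bigr => i _.
  by rewrite !(@fcoef_exp_trunc _ n.+1) // ltnS leq_subr.
rewrite (@fcoef_exp_trunc _ n.+1) //.
pose c i j : fps R :=
  fps_const (i`!%:R^-1 * j`!%:R^-1) * (f ^+ i * g ^+ j).
have TT : T f * T g = \sum_(i < n.+1) \sum_(j < n.+1) c i j.
  rewrite mulr_suml; apply: eq_bigr => i _; rewrite mulr_sumr.
  by apply: eq_bigr => j _; rewrite mulrACA -fps_constM.
have TD : T (f + g) = \sum_(k < n.+1) \sum_(i < k.+1) c i (k - i)%N.
  apply: eq_bigr => k _; rewrite addrC exprDn mulr_sumr.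
  apply: eq_bigr => i _.
  rewrite -[_ *+ 'C(k, i)]mulr_natl [g ^+ _ * _]mulrC mulrA; congr (_ * _).
  rewrite -fps_const_natr -fps_constM; congr fps_const.
  have le_ik : (i <= k)%N by rewrite -ltnS.
  rewrite -(bin_fact le_ik) !natrM.
  (* The binomial coefficient and both factorials divide the unit k!, hence are units themselves. *)
  have := factU k; rewrite -(bin_fact le_ik) !natrM !unitrM.
  move=> /and3P[uC ui uki].
  by rewrite invrM ?unitrM ?ui // divrK // invrM // mulrC.
rewrite -/(T _) TD TT !fcoef_sum.
transitivity (\sum_(i < n.+1) \sum_(k < n.+1 | (i <= k)%N)
                fcoef (c i (k - i)%N) n).
  rewrite (exchange_big_dep predT) //=; apply: eq_bigr => k _.
  rewrite fcoef_sum.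
  by rewrite (big_ord_widen n.+1 (fun i => fcoef (c i (k - i)%N) n)).
apply: eq_bigr => i _; rewrite fcoef_sum.
(* Here the part i + j > n of the square is discarded; what remains is the reindexing k = j + i. *)
transitivity (\sum_(j < n.+1 | (j < n.+1 - i)%N) fcoef (c i j) n); last first.
  rewrite big_mkcond; apply: eq_bigr => j _; case: ltnP => // le_j.
  by rewrite fcoefCM fcoefXM_small ?mulr0 // -leq_subLR.
have le_in : (i <= n.+1)%N by apply: ltnW.
rewrite -(big_ord_widen _ (fun j => fcoef (c i j) n)) ?leq_subr //.
rewrite -(big_mkord (fun k => (i <= k)%N) (fun k => fcoef (c i (k - i)%N) n)).
rewrite (big_cat_nat (n := i)) //= big_nat_cond big_pred0 ?add0r; last first.
  by move=> k; case: ltnP; rewrite ?andbF.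
rewrite -{1}[val i]add0n big_addn.
rewrite -(big_mkord xpredT (fun j => fcoef (c i j) n)).
by rewrite big_mkcond; apply: eq_bigr => j _; rewrite leq_addl addnK.
Qed.

Lemma fps_expMn f m : fcoef f 0 = 0 -> fps_exp (f *+ m) = fps_exp f ^+ m.
Proof.
move=> f0; elim: m => [|m IHm].
  rewrite mulr0n expr0; apply: fpsP => n.
  rewrite (@fcoef_exp_trunc _ n.+1) // big_ord_recl invr1 mul1r.
  rewrite expr0 big1 ?addr0 // => i _.
  by rewrite expr0n mulr0.
rewrite mulrSr exprSr -IHm fps_expD //.
by elim: m {IHm} => // m IHm; rewrite mulrSr fcoefD IHm f0 addr0.
Qed.
End FpsExp.

(** * The cofactor of the Bernoulli series and its coefficients *)

Section Weight.
Variable R : comUnitRingType.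
Hypothesis factU : forall n, (n`!%:R : R) \is a GRing.unit.
Local Notation t := fps_t.

Definition gauss : fps R := fps_exp (- t ^+ 2).
Definition expt1_divt : fps R := fps_divt (fps_exp t - 1).

Lemma expt1_divtK : expt1_divt * t = fps_exp t - 1.
Proof.
by apply: fps_divtK; rewrite fcoefB fcoef_exp_t fcoef1 invr1 subrr.
Qed.

Lemma fcoef_expt1_divt n : fcoef expt1_divt n = n.+1`!%:R^-1.
Proof.
rewrite -[LHS]/(fcoef (fps_exp t - 1) n.+1) fcoefB fcoef_exp_t fcoef1.
by rewrite subr0.
Qed.

Lemma expt1_divt_unit : expt1_divt \is a GRing.unit.
Proof. by rewrite fps_unitE fcoef_expt1_divt invr1 unitr1. Qed.

(** With [expt1_divt] as G, this is the factor e^(-t^2) G(2t)^r that remains when the rescaled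
    Bernoulli series is split off the Hermite series. *)
Definition weight (r : nat) : fps R :=
  fps_subst idfun 2%:R (expt1_divt ^+ r) * gauss.

(** Generating series of the k-th forward differences at 0 of j -> H_m(j)/m!. *)
Definition diff_gauss (k : nat) : fps R :=
  (fps_exp (2%:R * t) - 1) ^+ k * gauss.

Lemma fps_2tX_weight r k : (k <= r)%N ->
  fps_const (2%:R ^+ k) * (t ^+ k * weight r) =
  fps_subst idfun 2%:R (expt1_divt ^+ (r - k)) * diff_gauss k.
Proof.
move=> le_kr.
pose S := fps_subst idfun 2%:R : {rmorphism fps R -> fps R}.
have St : S t = 2%:R * t by rewrite [LHS]fps_subst_t fps_const_natr.
have SE : fps_exp (2%:R * t) - 1 = S expt1_divt * (2%:R * t).
  rewrite -St -rmorphM expt1_divtK rmorphB rmorph1; congr (_ - _).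
  by rewrite [RHS]fps_subst_exp.
have C2 : fps_const (2%:R ^+ k) = 2%:R ^+ k :> fps R.
  by rewrite -!natrX fps_const_natr.
(* Read s = G(2t), u = t, v = 2: of the r factors s, k absorb one v * u each and become e^(2t) -
   1. *)
have aux (A : comNzRingType) (s u g v : A) : v ^+ k * (u ^+ k * (s ^+ r * g)) =
    s ^+ (r - k) * ((s * (v * u)) ^+ k * g).
  by rewrite -{1}(subnK le_kr) exprD !exprMn; ring.
rewrite /diff_gauss SE C2 /weight -[fps_subst _ _ _]/(S _).
rewrite -[fps_subst _ _ (_ ^+ (r - k))]/(S _) !rmorphXn; exact: aux.
Qed.

Lemma fcoef_weight_low r k n : (k <= r)%N -> (k <= n)%N ->
  2%:R ^+ k * fcoef (weight r) (n - k) =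
  \sum_(l < n.+1) fcoef (expt1_divt ^+ (r - k)) l * 2%:R ^+ l
     * fcoef (diff_gauss k) (n - l).
Proof.
move=> le_kr le_kn.
transitivity (fcoef (fps_const (2%:R ^+ k) * (t ^+ k * weight r)) n).
  by rewrite fcoefCM fcoef_tXM le_kn.
by rewrite (fps_2tX_weight _ _ le_kr) fcoefM.
Qed.

(** Only r factors G(2t) are available, so r factors 2t exhaust them: no power of G survives, and
    2^(k-r) stays outside as a scalar. *)
Lemma fcoef_weight_high r k n : (r <= k <= n)%N ->
  2%:R ^+ k * fcoef (weight r) (n - k) =
  2%:R ^+ (k - r) * fcoef (diff_gauss r) (n - k + r).
Proof.
move=> /andP[le_rk le_kn].
have := fps_2tX_weight r r (leqnn r); rewrite subnn expr0.
move=> /(congr1 (fun f => fcoef f (n - k + r))).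
rewrite fcoefCM fcoef_tXM leq_addl addnK => E.
rewrite -{1}(subnK le_rk) exprD -mulrA E.
by rewrite [fps_subst _ _ 1](rmorph1 (fps_subst idfun 2%:R)) mul1r.
Qed.

End Weight.

Lemma fcoef_Mt0 {R : comNzRingType} (f : fps R) : fcoef (f * fps_t) 0 = 0.
Proof. by rewrite fcoef0M mulr0. Qed.

Lemma fcoef_Nt2 {R : comNzRingType} : fcoef (- fps_t ^+ 2 : fps R) 0 = 0.
Proof. by rewrite fcoefN fcoefX_small ?oppr0. Qed.

(** * Hermite values, Stirling numbers and the factorization of the Hermite series *)

Section Expansion.
Variable F : numFieldType.
Local Notation t := fps_t.
Local Notation P := {poly F}.

Let factF n : (n`!%:R : F) \is a GRing.unit.
Proof. by rewrite unitfE pnatr_eq0 -lt0n fact_gt0. Qed.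

Let factP n : (n`!%:R : P) \is a GRing.unit.
Proof. by rewrite -polyC_natr; apply: rmorph_unit. Qed.

Let hermite_coef n : fcoef (hermite_series F) n = n`!%:R^-1 *: hermite n.
Proof.
rewrite /hermite -polyC_natr mul_polyC scalerA mulVf ?scale1r //.
by rewrite -unitfE.
Qed.

Lemma hermite_horner_gf (a : F) :
  fps_subst (horner_eval a) 1 (hermite_series F)
  = fps_exp (2%:R * fps_const a * t) * gauss F.
Proof.
rewrite (fps_subst_exp _ _ _ factP).
rewrite -(fps_expD _ factF _ _ (fcoef_Mt0 _) fcoef_Nt2).
congr fps_exp; pose phi := fps_subst (horner_eval a) 1 : {rmorphism _ -> _}.
rewrite (rmorphB phi) (rmorphXn phi) !(rmorphM phi) (rmorph_nat phi).
by rewrite /phi /= fps_subst_const fps_subst_t /= /horner_eval hornerX mul1r.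
Qed.

(** Expand (e^(2t) - 1)^k binomially; each e^(2jt) e^(-t^2) is the Hermite series evaluated at x =
    j. *)
Lemma fcoef_diff_gauss k m :
  fcoef (diff_gauss F k) m =
  \sum_(j < k.+1) (-1) ^+ (k - j) * 'C(k, j)%:R * (hermite m).[j%:R] / m`!%:R.
Proof.
rewrite /diff_gauss addrC exprDn mulr_suml fcoef_sum; apply: eq_bigr => j _.
have -> : (-1) ^+ (k - j) * fps_exp (2%:R * t) ^+ j *+ 'C(k, j) * gauss F
    = fps_const ((-1) ^+ (k - j) * 'C(k, j)%:R)
      * fps_subst (horner_eval j%:R) 1 (hermite_series F).
  rewrite hermite_horner_gf fps_constM fps_const_sign !fps_const_natr.
  have -> : 2%:R * j%:R * t = (2%:R * t) *+ j :> fps F.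
    by rewrite mulrAC mulr_natr.
  rewrite (fps_expMn _ factF _ _ (fcoef_Mt0 _)).
  (* Over an abstract ring: the ring structures on [fps F] in the goal are
     only convertible, which defeats rewriting. *)
  have aux (A : comNzRingType) (s e g : A) c :
      s * e *+ c * g = s * c%:R * (e * g).
    by rewrite mulrnAl -!mulrA mulr_natl mulrnAr.
  exact: aux.
rewrite fcoefCM fcoef_subst expr1n mulr1 hermite_coef.
rewrite -[LHS]/(_ * (_ *: _).[_]) hornerZ.
by rewrite -!mulrA [_^-1 * _]mulrC.
Qed.

(** Since G^m t^m = (e^t - 1)^m, the coefficient is read off m degrees higher, whence the shifted
    index l + m. *)
Lemma fcoef_expt1_divtX m l :
  fcoef (expt1_divt F ^+ m) l = m`!%:R * stirling2 (l + m) m / (l + m)`!%:R.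
Proof.
have -> : fcoef (expt1_divt F ^+ m) l = fcoef ((fps_exp t - 1) ^+ m) (l + m).
  by rewrite -expt1_divtK exprMn mulrC fcoef_tXM leq_addl addnK.
rewrite /stirling2; set c := fcoef _ _.
by field; rewrite -!unitfE !factF.
Qed.

(** The powers of G(2t) cancel. The weight is taken over [F] and then embedded, so that its
    coefficients act as scalars on the Bernoulli polynomials. *)
Lemma hermite_series_bernoulli r :
  hermite_series F =
  fps_subst polyC 1 (weight F r) * fps_subst idfun 2%:R (bernoulli_series F r).
Proof.
pose L := fps_subst polyC 1 : {rmorphism fps F -> fps P}.
pose S := fps_subst idfun 2%:R : {rmorphism fps P -> fps P}.
have St : S t = 2%:R * t by rewrite [LHS]fps_subst_t fps_const_natr.
have Sx : S (fps_const 'X) = fps_const 'X by rewrite [LHS]fps_subst_const.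
have Lt : L t = t by rewrite [LHS]fps_subst_t mul1r.
have -> : hermite_series F = gauss P * S (fps_exp (fps_const 'X * t)).
  rewrite [S _](fps_subst_exp _ _ _ factP) -[fps_subst _ _ _]/(S _) rmorphM.
  rewrite Sx St mulrA -(fps_expD _ factP _ _ fcoef_Nt2 (fcoef_Mt0 _)).
  by congr fps_exp; rewrite /=; ring.
have Lg : L (gauss F) = gauss P.
  rewrite [L _](fps_subst_exp _ _ _ factF) -[fps_subst _ _ _]/(L _) rmorphN.
  by rewrite rmorphXn Lt.
(* G has the coefficients 1/(n+1)! over either ring, so embedding and rescaling are compared degree
   by degree. *)
have LG : L (fps_subst idfun 2%:R (expt1_divt F)) = S (expt1_divt P).
  apply: fpsP => n; rewrite !fcoef_subst !fcoef_expt1_divt expr1n mulr1.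
  by rewrite /= rmorphM rmorphXn rmorph_nat rmorphV // rmorph_nat.
have uG := expt1_divt_unit P.
have -> : fps_subst polyC 1 (weight F r) = S (expt1_divt P) ^+ r * gauss P.
  rewrite -[LHS]/(L _) rmorphM Lg -LG; congr (_ * _).
  by rewrite (rmorphXn (fps_subst idfun 2%:R)) rmorphXn.
rewrite -[fps_subst _ _ (bernoulli_series F r)]/(S _) rmorphM rmorphXn.
have SV : S (expt1_divt P) * S (expt1_divt P)^-1 = 1.
  by rewrite -rmorphM mulrV ?rmorph1.
have aux (A : comNzRingType) (u v g e : A) : u * v = 1 ->
    g * e = u ^+ r * g * (v ^+ r * e).
  by move=> uv; rewrite mulrACA -exprMn uv expr1n mul1r.
exact: aux.
Qed.

End Expansion.

Theorem theorem7 (F : numFieldType) (r n : nat) (hrn : (r <= n)%N) :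
  hermite n =
    n`!%:R *: (\sum_(0 <= k < r)
      (\sum_(0 <= j < k.+1) \sum_(0 <= l < n.+1)
         ((r - k)`!%:R * stirling2 (l + r - k) (r - k)
            * (-1) ^+ (k - j) * 'C(k, j)%:R * 2%:R ^+ l
            * (hermite (n - l)).[j%:R])
         / ((l + r - k)`!%:R * k`!%:R * (n - l)`!%:R))
      *: bernoulli r k)
  + n`!%:R *: (\sum_(r <= k < n.+1)
      (\sum_(0 <= j < r.+1)
         ((-1) ^+ (r - j) * 'C(r, j)%:R * 2%:R ^+ (k - r)
            * (hermite (n - k + r)).[j%:R])
         / (k`!%:R * (n - k + r)`!%:R))
      *: bernoulli r k)
  :> {poly F}.
Proof.
have factF m : (m`!%:R : F) != 0 by rewrite pnatr_eq0 -lt0n fact_gt0.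
have factU m : (m`!%:R : F) \is a GRing.unit by rewrite unitfE.
have bernoulliE k : fcoef (bernoulli_series F r) k = k`!%:R^-1 *: bernoulli r k.
  by rewrite /bernoulli -polyC_natr mul_polyC scalerA mulVf ?scale1r.
(* Coefficient of t^n in the factorization; 2^k comes from the rescaling t -> 2t and 1/k! from the
   normalization of the Bernoulli polynomials. *)
have -> : hermite n =
    n`!%:R *: \sum_(0 <= k < n.+1)
      (2%:R ^+ k * fcoef (weight F r) (n - k) / k`!%:R) *: bernoulli r k.
  rewrite /hermite -polyC_natr mul_polyC (hermite_series_bernoulli F r) mulrC.
  rewrite fcoefM big_mkord; congr (_ *: _); apply: eq_bigr => k _.
  rewrite !fcoef_subst bernoulliE expr1n mulr1 /= -polyC_natr -rmorphXn /=.
  rewrite -!mul_polyC !rmorphM; ring.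
rewrite -scalerDr (big_cat_nat (n := r)) ?leqW //; congr (_ *: (_ + _)).
  apply: eq_big_nat => k /andP[_ lt_kr]; congr (_ *: _).
  have le_kr := ltnW lt_kr.
  rewrite (fcoef_weight_low _ factU _ _ _ le_kr (leq_trans le_kr hrn)).
  (* The Cauchy product has the sum over l outermost, the statement the sum over j. *)
  rewrite mulr_suml exchange_big big_mkord; apply: eq_bigr => l _.
  rewrite fcoef_diff_gauss fcoef_expt1_divtX mulr_sumr mulr_suml big_mkord.
  (* For k <= r the truncated difference l + r - k equals l + (r - k), the index produced by the
     power r - k of G. *)
  apply: eq_bigr => j _; rewrite -addnBA //.
  by field; rewrite !factF.
apply: eq_big_nat => k /andP[le_rk le_kn]; congr (_ *: _).
rewrite (fcoef_weight_high _ factU); last by rewrite le_rk.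
rewrite fcoef_diff_gauss mulr_sumr mulr_suml big_mkord; apply: eq_bigr => j _.
by field; rewrite !factF.
Qed.
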